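(* Let $\zeta$ be a primitive fifth root of unity, $\alpha=\zeta-\zeta^2-\zeta^3+\zeta^4$ (so $\alpha^2=5$), $\varepsilon=\frac{-1+\alpha}{2}$, $\bar\varepsilon=\frac{-1-\alpha}{2}$, let $u$ be an indeterminate and $b=\frac{\varepsilon^5u^5+\bar\varepsilon^5}{u^5+1}$. Let $$X=\frac{-7+3\alpha}{4}\cdot\frac{(-2u^2+(1+\alpha)u-3\alpha-7)(2u^2+(4+2\alpha)u+3\alpha+7)}{(-2u^2+(1+\alpha)u-2)(u+1)^2},$$ which equals $$-\varepsilon^4\frac{[u-(1+\zeta)^2][u-\zeta(1+\zeta)^2][u-\zeta^2(1+\zeta)^2][u-\zeta^3(1+\zeta)^2]}{(u+\zeta^2)(u+\zeta^3)(u+1)^2},$$ and let $P=(X,Y)$ be a point on $E_5(b)$ with this $X$-coordinate. Then the $X$-coordinate of $2P$ is obtained by applying the mapping $(\alpha\to-\alpha,\ u\to1/u)$ to the first expression for $X$, or equivalently the mapping $(\zeta\to\zeta^2,\ u\to1/u)$ to the second expression.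
   Context: For a parameter $b$, $E_5(b)$ denotes the Tate normal form $Y^2+(1+b)XY+bY=X^3+bX^2$. Note $b$ is invariant under $(\alpha\to-\alpha,u\to1/u)$. *)

(* Defs.v *)
From HB Require Import structures.
From mathcomp Require Import all_boot all_order all_algebra.

Set Implicit Arguments.
Unset Strict Implicit.
Unset Printing Implicit Defensive.

Import GRing.Theory.
Local Open Scope ring_scope.

(* y^2 + a1 x y + a3 y = x^3 + a2 x^2 + a4 x + a6 *)
Record weierstrass (K : Type) := Weierstrass
  { wa1 : K; wa2 : K; wa3 : K; wa4 : K; wa6 : K }.

Inductive point (K : Type) := Infinity | Affine of K & K.
Arguments Infinity {K}.

Definition point_x (K : Type) (P : point K) : option K :=
  if P is Affine x _ then Some x else None.

Section Curve.
Variables (K : fieldType) (E : weierstrass K).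

Definition on_curve (P : point K) : bool :=
  if P is Affine x y then
    y ^+ 2 + wa1 E * x * y + wa3 E * y
      == x ^+ 3 + wa2 E * x ^+ 2 + wa4 E * x + wa6 E
  else true.

(* third point of the line of slope l through (x1, y1) and a point of
   abscissa x2, reflected by (x, y) |-> (x, - y - a1 x - a3) *)
Definition chord (l x1 y1 x2 : K) : point K :=
  let x3 := l ^+ 2 + wa1 E * l - wa2 E - x1 - x2 in
  Affine x3 (- (y1 + l * (x3 - x1)) - wa1 E * x3 - wa3 E).

(* The chord-tangent group law; meaningful on points satisfying [on_curve]. *)
Definition point_add (P Q : point K) : point K :=
  match P, Q with
  | Infinity, _ => Q
  | _, Infinity => P
  | Affine x1 y1, Affine x2 y2 =>
      if x1 != x2 then chord ((y2 - y1) / (x2 - x1)) x1 y1 x2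
      else if y1 + y2 + wa1 E * x1 + wa3 E == 0 then Infinity
      else chord ((3 * x1 ^+ 2 + 2 * wa2 E * x1 + wa4 E - wa1 E * y1)
                    / (2 * y1 + wa1 E * x1 + wa3 E)) x1 y1 x2
  end.

End Curve.

Definition tate5 (K : fieldType) (b : K) : weierstrass K :=
  Weierstrass (1 + b) b b 0 0.

Section Expressions.
Variable K : fieldType.
Implicit Types zeta alpha u : K.

Definition alpha_of zeta : K := zeta - zeta ^+ 2 - zeta ^+ 3 + zeta ^+ 4.

Definition eps alpha : K := (- 1 + alpha) / 2.
Definition eps_bar alpha : K := (- 1 - alpha) / 2.

Definition b_of alpha u : K :=
  (eps alpha ^+ 5 * u ^+ 5 + eps_bar alpha ^+ 5) / (u ^+ 5 + 1).

(* [X_alpha] and [X_zeta] are kept as expressions in the free parameters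
   (alpha, u), resp. (zeta, u), so that a mapping alpha -> alpha', u -> u' is
   applied to the expression by changing the arguments. *)
Definition X_alpha alpha u : K :=
  (- 7 + 3 * alpha) / 4
  * (((- 2 * u ^+ 2 + (1 + alpha) * u - 3 * alpha - 7)
        * (2 * u ^+ 2 + (4 + 2 * alpha) * u + 3 * alpha + 7))
     / ((- 2 * u ^+ 2 + (1 + alpha) * u - 2) * (u + 1) ^+ 2)).

Definition X_zeta zeta u : K :=
  - eps (alpha_of zeta) ^+ 4
  * (((u - (1 + zeta) ^+ 2)
        * (u - zeta * (1 + zeta) ^+ 2)
        * (u - zeta ^+ 2 * (1 + zeta) ^+ 2)
        * (u - zeta ^+ 3 * (1 + zeta) ^+ 2))
     / ((u + zeta ^+ 2) * (u + zeta ^+ 3) * (u + 1) ^+ 2)).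

End Expressions.

(* Main.v *)
(** By the duplication formula x(2P) = N(x) / D(x) and a Bezout relation
    between N and D, doubling is determined by the identity N(X) = X' D(X) as
    soon as the discriminant b^5 (b^2 + 11 b - 1) does not vanish.  In terms of
    e = (alpha - 1) / 2, where e^2 = 1 - e, both X and its conjugate X' have
    denominators dividing powers of
    u^5 + 1 = (u + 1) (u^2 - (e + 1) u + 1) (u^2 + e u + 1),
    and the identity becomes polynomial in e and u.  Specializing u = 1 gives
    b = -11/2 and b^2 + 11 b - 1 = -125/4, so the discriminant is nonzero. *)
Require Import Defs.
From HB Require Import structures.
From mathcomp Require Import all_boot all_order all_algebra.
From mathcomp Require Import ring.
Import GRing.Theory.
Local Open Scope ring_scope.

Section Doubling.
Variables (K : fieldType) (b : K).

(** In the standard invariants b2 = (1 + b)^2 + 4 b, b4 = (1 + b) b, b6 = b^2, b8 = b^3 of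
    [tate5 b], this is x^4 - b4 x^2 - 2 b6 x - b8. *)
Definition dbl_num (x : K) : K :=
  x ^+ 4 - (1 + b) * b * x ^+ 2 - 2 * b ^+ 2 * x - b ^+ 3.

Definition dbl_den (x : K) : K :=
  4 * x ^+ 3 + ((1 + b) ^+ 2 + 4 * b) * x ^+ 2 + 2 * (1 + b) * b * x + b ^+ 2.

Lemma dbl_bezout (x : K) :
  let b2 := (1 + b) ^+ 2 + 4 * b in let b4 := (1 + b) * b in
  (12 * x ^+ 3 - b2 * x ^+ 2 - 10 * b4 * x + b2 * b4 - 27 * b ^+ 2) * dbl_den x
  - (48 * x ^+ 2 + 8 * b2 * x + 32 * b4 - b2 ^+ 2) * dbl_num x
  = - (b ^+ 5 * (b ^+ 2 + 11 * b - 1)).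
Proof. by rewrite /dbl_num /dbl_den /=; ring. Qed.

Lemma point_x_double (x y : K) :
  on_curve (tate5 b) (Affine x y) -> dbl_den x != 0 ->
  point_x (point_add (tate5 b) (Affine x y) (Affine x y))
  = Some (dbl_num x / dbl_den x).
Proof.
move=> /eqP /= Exy den_neq0.
(* Denominator of the tangent slope; its square is [dbl_den x] modulo the curve equation [eqn]. *)
pose psi := 2 * y + (1 + b) * x + b.
pose eqn := (y ^+ 2 + (1 + b) * x * y + b * y)
            - (x ^+ 3 + b * x ^+ 2 + 0 * x + 0).
have eqn0 : eqn = 0 by rewrite /eqn Exy subrr.
have psi2 : psi ^+ 2 = dbl_den x.
  have -> : psi ^+ 2 = dbl_den x + 4 * eqn by rewrite /psi /dbl_den /eqn; ring.
  by rewrite eqn0 mulr0 addr0.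
have psi_neq0 : psi != 0.
  by apply: contraNneq den_neq0 => psi0; rewrite -psi2 psi0 expr0n.
rewrite eqxx /=.
have -> : y + y + (1 + b) * x + b = psi by rewrite /psi; ring.
rewrite (negPf psi_neq0) /= -psi2; congr Some.
(* The tangent formula yields [dbl_num x] only modulo [eqn], with cofactor 8 x + b2. *)
transitivity ((dbl_num x - (8 * x + (1 + b) ^+ 2 + 4 * b) * eqn) / psi ^+ 2).
  by rewrite /dbl_num /eqn /psi; field; exact: psi_neq0.
by rewrite eqn0 mulr0 subr0.
Qed.

(* If the denominator vanished, so would the numerator, and then the
   discriminant by the Bezout relation. *)
Lemma point_x_double_eq (x y x' : K) :
  on_curve (tate5 b) (Affine x y) ->
  b ^+ 5 * (b ^+ 2 + 11 * b - 1) != 0 ->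
  dbl_num x = x' * dbl_den x ->
  point_x (point_add (tate5 b) (Affine x y) (Affine x y)) = Some x'.
Proof.
move=> Exy disc_neq0 num_eq.
have den_neq0 : dbl_den x != 0.
  apply: contraNneq disc_neq0 => den0.
  by rewrite -oppr_eq0 -(dbl_bezout x) num_eq den0 !mulr0 subrr.
by rewrite point_x_double // num_eq mulfK.
Qed.

End Doubling.

Lemma four_neq0 {K : fieldType} : 2 != 0 :> K -> 4 != 0 :> K.
Proof.
by move=> two_neq0; rewrite (_ : 4 = 2 * 2); [apply: mulf_neq0 | ring].
Qed.

Section Parametrization.
Variables (K : fieldType) (e u : K).
Hypotheses (two_neq0 : 2 != 0 :> K) (e2 : e ^+ 2 = 1 - e).

(** Reducing by [e2] gives e^5 = 5 e - 3; the conjugation e -> -1 - e turns this into -5 e - 8. *)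
Lemma b_of_eps :
  b_of (2 * e + 1) u = ((5 * e - 3) * u ^+ 5 - (5 * e + 8)) / (u ^+ 5 + 1).
Proof.
rewrite /b_of; congr (_ / _).
have -> : eps (2 * e + 1) = e by rewrite /eps; field.
have -> : eps_bar (2 * e + 1) = - 1 - e by rewrite /eps_bar; field.
by ring: e2.
Qed.

(** For e = z + z^4 with z a primitive fifth root of unity, the quadratics are (u + z^2)(u + z^3)
    and (u + z)(u + z^4), exchanged by e -> -1 - e. *)
Lemma factor_u5 :
  u ^+ 5 + 1
  = (u + 1) * (u ^+ 2 - (e + 1) * u + 1) * (u ^+ 2 + e * u + 1).
Proof. by ring: e2. Qed.

Hypotheses (u_neq0 : u != 0) (u5_neq0 : u ^+ 5 + 1 != 0).

Lemma dbl_X_alpha (b := b_of (2 * e + 1) u) (x := X_alpha (2 * e + 1) u) :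
  dbl_num K b x = X_alpha (- (2 * e + 1)) u^-1 * dbl_den K b x.
Proof.
move: (u5_neq0); rewrite factor_u5 !mulf_eq0 !negb_or.
move=> /andP[/andP[s_neq0 q1_neq0] q2_neq0].
have four_neq0 := four_neq0 two_neq0.
rewrite /x /b b_of_eps factor_u5.
have -> : X_alpha (2 * e + 1) u =
  (3 * e - 2) * (u ^+ 2 - (e + 1) * u + 3 * e + 5)
     * (u ^+ 2 + (2 * e + 3) * u + 3 * e + 5)
  / ((u ^+ 2 - (e + 1) * u + 1) * (u + 1) ^+ 2).
  rewrite /X_alpha.
  have -> : -2 * u ^+ 2 + (1 + (2 * e + 1)) * u - 2
    = -2 * (u ^+ 2 - (e + 1) * u + 1) by ring.
  by field; rewrite s_neq0 q1_neq0 oppr_eq0 two_neq0 four_neq0.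
have -> : X_alpha (- (2 * e + 1)) u^-1 =
  - (3 * e + 5) * (1 + e * u + (2 - 3 * e) * u ^+ 2)
     * (1 + (1 - 2 * e) * u + (2 - 3 * e) * u ^+ 2)
  / ((u ^+ 2 + e * u + 1) * (u + 1) ^+ 2).
  rewrite /X_alpha.
  (* The quadratic u^2 + e u + 1 is palindromic, so u -> 1/u merely divides it by u^2. *)
  have -> : -2 * u^-1 ^+ 2 + (1 + - (2 * e + 1)) * u^-1 - 2
    = -2 * (u ^+ 2 + e * u + 1) / u ^+ 2 by field.
  have -> : u^-1 + 1 = (u + 1) / u by field.
  by field; rewrite s_neq0 q2_neq0 u_neq0 oppr_eq0 two_neq0 four_neq0.
rewrite /dbl_num /dbl_den.
by field: e2; rewrite q2_neq0 q1_neq0 s_neq0.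
Qed.

End Parametrization.

Lemma prim5_sum0 {K : fieldType} {z : K} :
  5.-primitive_root z -> z ^+ 4 = - 1 - z - z ^+ 2 - z ^+ 3.
Proof.
move=> z_prim; have z5 := prim_expr_order z_prim.
have z_neq1 : z - 1 != 0 by rewrite subr_eq0 -(prim_order_dvd z_prim 1).
apply: (mulfI z_neq1); apply: subr0_eq.
by transitivity (z ^+ 5 - 1); [ring | rewrite z5 subrr].
Qed.

Section ZetaExpressions.
Variables (K : fieldType) (z : K).
Hypotheses (two_neq0 : 2 != 0 :> K) (z4 : z ^+ 4 = - 1 - z - z ^+ 2 - z ^+ 3).

Lemma alpha_of_sqr : alpha_of z ^+ 2 = 5.
Proof. by rewrite /alpha_of; ring: z4. Qed.

Lemma alpha_of_conj : alpha_of (z ^+ 2) = - alpha_of z.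
Proof. by rewrite /alpha_of; ring: z4. Qed.

(** Makes [X_alpha_zeta] applicable to z^2, that is, to the conjugate expression. *)
Lemma conj_sum0 :
  (z ^+ 2) ^+ 4 = - 1 - z ^+ 2 - (z ^+ 2) ^+ 2 - (z ^+ 2) ^+ 3.
Proof. by ring: z4. Qed.

(** Since z^k (1 + z)^2 = z^(k+1) (2 + z + z^4), the factors k = 0, 3 and k = 1, 2 pair up into
    quadratics with coefficients in alpha. *)
Lemma X_alpha_zeta (u : K) : X_alpha (alpha_of z) u = X_zeta z u.
Proof.
have four_neq0 := four_neq0 two_neq0.
rewrite /X_alpha /X_zeta /eps; set a := alpha_of z.
have -> : -2 * u ^+ 2 + (1 + a) * u - 2
  = -2 * ((u + z ^+ 2) * (u + z ^+ 3)) by rewrite /a /alpha_of; ring: z4.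
have -> : -2 * u ^+ 2 + (1 + a) * u - 3 * a - 7
  = - 2 * ((u - (1 + z) ^+ 2) * (u - z ^+ 3 * (1 + z) ^+ 2)).
  by rewrite /a /alpha_of; ring: z4.
have -> : 2 * u ^+ 2 + (4 + 2 * a) * u + 3 * a + 7
  = 2 * ((u - z * (1 + z) ^+ 2) * (u - z ^+ 2 * (1 + z) ^+ 2)).
  by rewrite /a /alpha_of; ring: z4.
rewrite (invfM (-2 * _)) (invfM (-2)) (invfM ((u + z ^+ 2) * _)).
(* The inverses become atoms because these factors may vanish. *)
move: (((u + z ^+ 2) * (u + z ^+ 3))^-1) (((u + 1) ^+ 2)^-1) => q s.
move: a (alpha_of_sqr : a ^+ 2 = 5) => a a2.
by field: a2; rewrite oppr_eq0 two_neq0 four_neq0.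
Qed.

End ZetaExpressions.

(* [rmorph_nat] comes first: numerals would otherwise match [rmorphD]. *)
Local Notation rmorphE :=
  (rmorph_nat, rmorphD, rmorphB, rmorphM, rmorphXn, rmorphN, rmorph1)
  (only parsing).

Lemma rmorph_b_of {K L : fieldType} (f : {rmorphism K -> L}) (a u : K) :
  f (b_of a u) = b_of (f a) (f u).
Proof. by rewrite /b_of /eps /eps_bar !(fmorphV, rmorphE). Qed.

Lemma rmorph_X_alpha {K L : fieldType} (f : {rmorphism K -> L}) (a u : K) :
  f (X_alpha a u) = X_alpha (f a) (f u).
Proof. by rewrite /X_alpha !(fmorphV, rmorphE). Qed.

Lemma rmorph_eps {K L : fieldType} (f : {rmorphism K -> L}) (a : K) :
  f (eps a) = eps (f a).
Proof. by rewrite /eps !(fmorphV, rmorphE). Qed.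

Lemma rmorph_alpha_of {K L : fieldType} (f : {rmorphism K -> L}) (z : K) :
  f (alpha_of z) = alpha_of (f z).
Proof. by rewrite /alpha_of !rmorphE. Qed.

Theorem theorem3p1 (F : fieldType) (charF0 : [pchar F] =i pred0)
    (zeta0 : F) (zeta0_prim : 5.-primitive_root zeta0)
    (L : fieldType) (iota : {rmorphism {fraction {poly F}} -> L}) :
  let zeta : {fraction {poly F}} := tofrac (zeta0%:P) in
  let u : {fraction {poly F}} := tofrac 'X in
  let alpha := alpha_of zeta in
  let E5b := tate5 (iota (b_of alpha u)) in
  let X := X_alpha alpha u in
  [/\ alpha ^+ 2 = 5,
      X = X_zeta zeta u &
      forall Y : L,
        let P := Affine (iota X) Y in
        on_curve E5b P ->
        point_x (point_add E5b P P) = Some (iota (X_alpha (- alpha) u^-1)) /\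
        point_x (point_add E5b P P) = Some (iota (X_zeta (zeta ^+ 2) u^-1))].
Proof.
move=> zeta u alpha E5b X.
have natF n : (n%:R == 0 :> F) = (n == 0) by move/pcharf0P: charF0 => ->.
pose phi : {rmorphism F -> {fraction {poly F}}} := @tofrac {poly F} \o polyC.
have z4 : zeta ^+ 4 = - 1 - zeta - zeta ^+ 2 - zeta ^+ 3.
  by apply: prim5_sum0; rewrite -[zeta]/(phi zeta0) fmorph_primitive_root.
have two_neq0 : 2 != 0 :> {fraction {poly F}}.
  by rewrite -(rmorph_nat phi) fmorph_eq0 natF.
have two_neq0L : 2 != 0 :> L by rewrite -(rmorph_nat iota) fmorph_eq0.
have conjE : X_zeta (zeta ^+ 2) u^-1 = X_alpha (- alpha) u^-1.
  by rewrite -X_alpha_zeta ?conj_sum0 // alpha_of_conj.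
split; [exact: alpha_of_sqr | exact: X_alpha_zeta | move=> Y P onP].
rewrite conjE; suff -> : point_x (point_add E5b P P)
  = Some (iota (X_alpha (- alpha) u^-1)) by [].
(* In L, b is a quotient of images of polynomials over F, so nonvanishing can be tested on
   polynomials. *)
pose psi : {rmorphism {poly F} -> L} := iota \o @tofrac {poly F}.
pose e0 := eps (alpha_of zeta0); pose e := psi e0%:P; pose w := psi 'X.
have eE : e = eps (iota alpha).
  by rewrite /e /e0 -[psi _]/(iota (phi _)) !rmorph_eps rmorph_alpha_of.
have alphaE : iota alpha = 2 * e + 1 by rewrite eE /eps; field.
have e2 : e ^+ 2 = 1 - e.
  have a2 : (2 * e + 1) ^+ 2 = 5.
    by rewrite -alphaE -rmorphXn (alpha_of_sqr _ _ z4) rmorph_nat.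
  apply: (mulfI (four_neq0 two_neq0L)).
  transitivity ((2 * e + 1) ^+ 2 - 4 * e - 1); first by ring.
  by rewrite a2; ring.
clearbody e0.
(* Specialization at u = 1 detects nonzero rational functions. *)
pose ev : {rmorphism {poly F} -> F} := horner_eval 1.
have psi_neq0 (p : {poly F}) : ev p != 0 -> psi p != 0.
  apply: contraNneq => /eqP; rewrite fmorph_eq0 tofrac_eq0 => /eqP ->.
  by rewrite rmorph0.
have ev_e : ev e0%:P = e0 by exact: hornerC.
have ev_w : ev 'X = 1 :> F by exact: hornerX.
(* b is [c0] / [d0]; at u = 1 the terms in [e0] cancel, leaving -11 / 2. *)
pose c0 : {poly F} := (5 * e0%:P - 3) * 'X ^+ 5 - (5 * e0%:P + 8).
pose d0 : {poly F} := 'X ^+ 5 + 1.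
have c1 : ev c0 = -11.
  by rewrite /c0 !rmorphE ev_e ev_w; ring.
have d1 : ev d0 = 2.
  by rewrite /d0 !rmorphE ev_w; ring.
have psi_c : psi c0 = (5 * e - 3) * w ^+ 5 - (5 * e + 8).
  by rewrite /c0 !rmorphE.
have psi_d : psi d0 = w ^+ 5 + 1 by rewrite /d0 !rmorphE.
clearbody c0 d0.
have w_neq0 : w != 0 by rewrite psi_neq0 // ev_w oner_eq0.
have d_neq0 : psi d0 != 0 by rewrite psi_neq0 // d1 natF.
have c_neq0 : psi c0 != 0 by rewrite psi_neq0 // c1 oppr_eq0 natF.
(* This is b^2 + 11 b - 1 multiplied by the square of the denominator [d0]. *)
have disc_neq0 : psi (c0 ^+ 2 + 11 * c0 * d0 - d0 ^+ 2) != 0.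
  apply: psi_neq0.
  rewrite !rmorphE c1 d1.
  have -> : (-11) ^+ 2 + 11 * -11 * 2 - 2 ^+ 2 = - 125 :> F by ring.
  by rewrite oppr_eq0 natF.
have bE : iota (b_of alpha u) = psi c0 / psi d0.
  by rewrite rmorph_b_of alphaE b_of_eps // psi_c psi_d.
apply: point_x_double_eq => //.
  rewrite bE mulf_neq0 ?expf_neq0 ?mulf_neq0 ?invr_neq0 //.
  have -> : (psi c0 / psi d0) ^+ 2 + 11 * (psi c0 / psi d0) - 1
    = psi (c0 ^+ 2 + 11 * c0 * d0 - d0 ^+ 2) / psi d0 ^+ 2.
    by rewrite !rmorphE; field.
  by rewrite mulf_neq0 ?invr_eq0 ?expf_neq0.
rewrite rmorph_b_of !rmorph_X_alpha rmorphN fmorphV alphaE.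
by apply: dbl_X_alpha; rewrite // -psi_d.
Qed.
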